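(* Let $N_1,\ldots,N_r\ge 2$ be integers, let $1\le k<r$, set $m=N_1\cdots N_k$ and $n=N_{k+1}\cdots N_r$, and suppose (without loss of generality) that $m\ge n$. Let $$H_{m,n}=\prod_{i=0}^{n-1}\frac{(m+i)!}{i!}.$$ Let $\underline{z}_1,\ldots,\underline{z}_{mn}$ be vectors of length $r$, and write $\underline{z}_i=(\underline{z}'_i,\underline{z}''_i)$ with $\underline{z}'_i=(z_i^{(1)},\ldots,z_i^{(k)})$ and $\underline{z}''_i=(z_i^{(k+1)},\ldots,z_i^{(r)})$. Then the multivariable Vandermonde determinant satisfies $$\det V_{(N_1,\ldots,N_r)}(\underline{z}_1,\ldots,\underline{z}_{mn})=\frac{1}{H_{m,n}}\sum_{\sigma\in\Sigma_{mn}}\varepsilon(\sigma)\prod_{i=1}^n\det V_{(N_1,\ldots,N_k)}\bigl(\underline{z}'_l,\ l\in\mathrm{col}_i({}^{\sigma}1_{n^m})\bigr)\prod_{j=1}^m\det V_{(N_{k+1},\ldots,N_r)}\bigl(\underline{z}''_l,\ l\in\mathrm{row}_j({}^{\sigma}1_{n^m})\bigr),$$ where $\Sigma_{mn}$ is the symmetric group acting by permutations of $\{1,\ldots,mn\}$, $\varepsilon(\sigma)$ is the sign of $\sigma$, $\mathrm{col}_i({}^{\sigma}1_{n^m})$ denotes the elements in the $i$-th column of ${}^{\sigma}1_{n^m}$ ordered from top to bottom, and $\mathrm{row}_j({}^{\sigma}1_{n^m})$ denotes the elements in the $j$-th row ordered from left to right.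
   Context: Vandermonde matrices. For integers $M_1,\ldots,M_s\ge 2$ with product $M=M_1\cdots M_s$, let $(e_1,\ldots,e_M)$ be the monomials in $s$ variables $z^{(1)},\ldots,z^{(s)}$ which are of degree $\le M_t-1$ in each $z^{(t)}$, ordered degree-lexicographically: first with respect to the total degree (from smallest to largest), and then within each degree by the lexicographic order (for instance, for $(M_1,M_2)=(2,2)$ the list is $1,\ z^{(1)},\ z^{(2)},\ z^{(1)}z^{(2)}$). For vectors $\underline{z}_1,\ldots,\underline{z}_M$ of length $s$, $V_{(M_1,\ldots,M_s)}(\underline{z}_1,\ldots,\underline{z}_M)$ is the $M\times M$ matrix with $(i,j)$ entry $e_j(\underline{z}_i)$. Tableaux. $1_{n^m}$ is the array with $m$ rows and $n$ columns in which $1,\ldots,mn$ are placed consecutively down the first column, then down the second column, etc., so that its entry in row $i$ and column $j$ is $i+(j-1)m$. For $\sigma\in\Sigma_{mn}$, ${}^{\sigma}1_{n^m}$ is the (not necessarily standard) tableau obtained from $1_{n^m}$ by permuting its entries, i.e. replacing each entry $l$ by $\sigma(l)$.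
   Formalization: The printed identity fails in sign, e.g. for (N_1,N_2)=(3,2), k=1; the formal version multiplies the right-hand side by the sign of the permutation between the degree-lexicographic order of the monomials and the order in which 1_{n^m} lists the products of the smaller monomials. *)

(* Defs.v *)
From HB Require Import structures.
From mathcomp Require Import all_boot all_order all_algebra all_fingroup.

Set Implicit Arguments.
Unset Strict Implicit.
Unset Printing Implicit Defensive.

Import Order.TTheory GRing.Theory.
Local Open Scope ring_scope.

(* The exponent vector e : {ffun 'I_s -> nat} stands for the monomial
   \prod_t z^(t) ^+ e t. *)
Definition expdeg s (e : {ffun 'I_s -> nat}) : nat := (\sum_t e t)%N.

(* "e is listed no later than f".  Within a degree, z^(1) comes before z^(2)
   and so on, i.e. the lexicographically LARGER exponent vector comes first:
   1, z1, z2, z1^2, z1 z2, z2^2, ... *)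
Definition deglex s (e f : {ffun 'I_s -> nat}) : bool :=
  (expdeg e < expdeg f)%N ||
  (expdeg e == expdeg f) &&
    (([seq f t | t : 'I_s] : seqlexi nat) <= [seq e t | t : 'I_s])%O.

Definition monomials s (Ms : 'I_s -> nat) : seq {ffun 'I_s -> nat} :=
  sort (@deglex s)
    [seq [ffun t => val (e t)] | e : {dffun forall t : 'I_s, 'I_(Ms t)}].

Lemma size_monomials s (Ms : 'I_s -> nat) :
  size (monomials Ms) = (\prod_t Ms t)%N.
Proof.
rewrite /monomials size_sort size_map -cardE card_dep_ffun foldrE big_map.
by rewrite big_enum /=; apply: eq_bigr => t _; rewrite card_ord.
Qed.

Definition monomial s (Ms : 'I_s -> nat) (j : nat) : {ffun 'I_s -> nat} :=
  nth [ffun=> 0%N] (monomials Ms) j.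

(* The number M of points is a separate parameter, to avoid casts; it is meant
   to be used with M = \prod_t Ms t, the size of monomials Ms. *)
Definition vandermonde (R : comUnitRingType) s (Ms : 'I_s -> nat) M
    (z : 'I_M -> 'rV[R]_s) : 'M[R]_M :=
  \matrix_(i, j) \prod_t z i 0 t ^+ monomial Ms j t.

Lemma tab_subproof m n (i : 'I_m) (j : 'I_n) : (i + j * m < m * n)%N.
Proof.
apply: (@leq_trans (m + j * m)%N); first by rewrite ltn_add2r.
by rewrite -mulSn mulnC leq_mul2l ltn_ord orbT.
Qed.

(* The tableau 1_{n^m} (m rows, n columns, filled down successive columns),
   with rows, columns and entries numbered from 0. *)
Definition tab m n (i : 'I_m) (j : 'I_n) : 'I_(m * n) :=
  Ordinal (tab_subproof i j).

Definition tabcol m n (s : 'S_(m * n)) (j : 'I_n) : 'I_m -> 'I_(m * n) :=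
  fun i => s (tab i j).

Definition tabrow m n (s : 'S_(m * n)) (i : 'I_m) : 'I_n -> 'I_(m * n) :=
  fun j => s (tab i j).

(* Each factor is an exact division. *)
Definition hookH m n : nat := (\prod_(i < n) ((m + i)`! %/ i`!))%N.

(* The product of the i-th monomial in z^(1..k) and the j-th monomial in
   z^(k+1..k+l). *)
Definition prodmonomial k l (N : 'I_(k + l) -> nat) (i j : nat) :
    {ffun 'I_(k + l) -> nat} :=
  [ffun t => match split t with
             | inl a => monomial (fun t => N (lshift l t)) i a
             | inr b => monomial (fun t => N (rshift k t)) j b
             end].

(* The products e'_i e''_j can be listed in two ways: in degree-lexicographic
   order, or following the entries of 1_{n^m}.  This counts the inversions
   between the two lists; for N = (2,2) they agree, for N = (3,2) the lists
     1, z1, z2, z1^2, z1 z2, z1^2 z2  and  1, z1, z1^2, z2, z1 z2, z1^2 z2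
   differ by one transposition.  *)
Definition order_inversions k l (N : 'I_(k + l) -> nat) m n : nat :=
  #|[set cd : ('I_m * 'I_n) * ('I_m * 'I_n) |
      (tab cd.1.1 cd.1.2 < tab cd.2.1 cd.2.2)%N &&
      ~~ deglex (prodmonomial N cd.1.1 cd.1.2)
                (prodmonomial N cd.2.1 cd.2.2)]|.

(* Main.v *)
Require Import Defs.
From HB Require Import structures.
From mathcomp Require Import all_boot all_order all_algebra all_fingroup.
From mathcomp Require Import ring.
From mathcomp Require Import ssrcomplements mpoly bigenough.

Set Implicit Arguments.
Unset Strict Implicit.
Unset Printing Implicit Defensive.

Import Order.TTheory GRing.Theory Num.Theory BigEnough.
Local Open Scope ring_scope.

(** Write [e_p] for the row of the values at [z'_p] of the [m] monomials in the
first [k] variables, and [f_p] for the row of the values at [z''_p] of the [n]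
monomials in the other ones.  Up to the order of its columns, the big
Vandermonde matrix has the entries [e_p,i * f_p,j], where [p] is a point and
[(i, j)] a cell of the [m] by [n] tableau; the permutation between the two
column orders has the parity of [order_inversions].  So the theorem is an
identity ([tableau_expansion]) about two arbitrary matrices [e] and [f].

To prove it, let [X] be an [m] by [m] matrix of indeterminates and consider the
square matrix [M] with the entries [f_p,j * (\sum_a e_p,a X_i,a)].  It is the
product of the matrix [(e_p,i * f_p,j)] with [n] diagonal copies of [X^T], so
[det M = det (e_p,i * f_p,j) * (det X)^n] ([det_mixed]).  Apply to both sides
the [n]-th power of the operator [det (d/dX)].

On the right, Cayley's identity
[det (d/dX) (det X)^s = s (s+1) ... (s+m-1) (det X)^(s-1)] ([detdiff_detX])
leaves the hook product times [det (e_p,i * f_p,j)].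

On the left, expand [det M] over the bijections [sigma] from cells to points.
Each term is a product of [m * n] linear forms, so that differentiating it
sums over the ways of matching the derivatives with the forms ([fischer_prod]).
As the forms of row [i] of the tableau involve row [i] of [X] only, the
matchings are the permutations [u] that preserve the rows.  Absorbing [u] into
[sigma] moves it into the indices of [f], where the signed sum over all [u] is
a product of row determinants, while the signed sum over the terms of
[det (d/dX)^n] is a product of column determinants of [e].

Everything takes place in the Fischer pairing of polynomials,
[fischer f p = (p(d/dX) f)(0)], for which multiplication by [det X] is adjoint
to [det (d/dX)]. *)

(** * Derivations *)

Section Derivation.
Variables (P : comNzRingType) (D : {additive P -> P}).
Hypothesis DM : forall p q, D (p * q) = D p * q + p * D q.

Lemma der1 : D 1 = 0.
Proof.
by apply: (addrI (D 1)); rewrite addr0 -{3}[1]mulr1 DM mulr1 mul1r.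
Qed.

Lemma der_sign (e : nat) p : D ((-1) ^+ e * p) = (-1) ^+ e * D p.
Proof.
by rewrite -signr_odd; case: odd; rewrite ?expr0 ?expr1 ?mulN1r ?raddfN ?mul1r.
Qed.

Lemma der_prod_eq0 I (r : seq I) (Q : pred I) F :
  (forall i, Q i -> D (F i) = 0) -> D (\prod_(i <- r | Q i) F i) = 0.
Proof.
move=> F0; elim/big_rec: _ => [|i p Qi Dp0]; first exact: der1.
by rewrite DM F0 // Dp0 mulr0 mul0r addr0.
Qed.

Lemma der_prod (I : eqType) (r : seq I) F : uniq r ->
  D (\prod_(i <- r) F i) =
  \sum_(i <- r) D (F i) * \prod_(j <- r | j != i) F j.
Proof.
elim: r => [|i r IHr] /=; first by rewrite !big_nil der1.
case/andP=> ir Ur; rewrite !big_cons DM IHr // eqxx /=; congr (_ * _ + _).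
  rewrite big_seq_cond [RHS]big_seq_cond; apply: eq_bigl => j.
  by case: (boolP (j \in r)) => //= jr; rewrite (memPn ir).
rewrite mulr_sumr; apply: eq_big_seq => j jr.
by rewrite big_cons eq_sym (memPn ir) // mulrCA.
Qed.

Lemma der_det_eq0 n (A : 'M[P]_n) : (forall i j, D (A i j) = 0) ->
  D (\det A) = 0.
Proof.
move=> A0; rewrite raddf_sum big1 // => s _.
by rewrite der_sign der_prod_eq0 ?mulr0.
Qed.

(** Multiplying by [p] avoids the exponent [s - 1]. *)
Lemma der_exp p s : p * D (p ^+ s) = s%:R * p ^+ s * D p.
Proof.
elim: s => [|s IHs]; first by rewrite expr0 der1 mulr0 !mul0r.
rewrite exprS DM mulrDr [p * (p * _)]mulrCA [p * D _]IHs -natr1; ring.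
Qed.

End Derivation.

(** * Cayley's identity up to powers of the determinant *)

Section Cayley.
Variables (P : comNzRingType) (m : nat) (D : 'I_m -> 'I_m -> {additive P -> P}).
Variable X : 'M[P]_m.
Hypothesis DM : forall i j p q, D i j (p * q) = D i j p * q + p * D i j q.
Hypothesis DX : forall i j k l, D i j (X k l) = ((i == k) && (j == l))%:R.

Lemma der_det i j : D i j (\det X) = (\adj X) j i.
Proof.
(* the cofactors along row i do not involve row i *)
rewrite (expand_det_row _ i) /cofactor raddf_sum (bigD1 j) //=.
rewrite big1 ?addr0 => [|a /negPf aj].
  rewrite DM DX !eqxx mul1r der_sign (der_det_eq0 (DM _ _)).
    by rewrite !mulr0 addr0 !mxE.
  by move=> k l; rewrite !mxE DX (negPf (neq_lift i k)).
rewrite DM DX eq_sym aj andbF mul0r add0r der_sign.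
rewrite (der_det_eq0 (DM _ _)) ?mulr0 // => k l.
by rewrite !mxE DX (negPf (neq_lift i k)).
Qed.

(** Differentiate [adj X * X = (det X) I] and multiply by [adj X] on the right:
this is the rule [d (X^-1) = - X^-1 dX X^-1] without denominators. *)
Lemma der_adj i j k l :
  \det X * D i j ((\adj X) k l) =
  (\adj X) k l * (\adj X) j i - (\adj X) k i * (\adj X) j l.
Proof.
set Y := \adj X.
have DYX b : \sum_a D i j (Y k a) * X a b =
    (k == b)%:R * Y j i - Y k i * (j == b)%:R.
  apply/eqP; rewrite eq_sym subr_eq; apply/eqP.
  have := congr1 (fun M : 'M_m => M k b) (mul_adj_mx X).
  rewrite mxE [RHS]mxE => /(congr1 (D i j)).
  rewrite raddfMn der_det -/Y mulr_natl => <-; rewrite raddf_sum.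
  under eq_bigr do rewrite DM DX; rewrite big_split /=; congr (_ + _).
  rewrite (bigD1 i) //= big1 ?addr0 => [|a ai]; first by rewrite eqxx mulr_natr.
  by rewrite eq_sym (negPf ai) mulr0.
have XY a b : \sum_c X a c * Y c b = \det X *+ (a == b).
  by have := congr1 (fun M : 'M_m => M a b) (mul_mx_adj X); rewrite !mxE.
transitivity (\sum_b (\sum_a D i j (Y k a) * X a b) * Y b l).
  under eq_bigr do rewrite mulr_suml; rewrite exchange_big /=.
  under eq_bigr => a _.
    under eq_bigr do rewrite -mulrA.
    rewrite -mulr_sumr XY; over.
  rewrite (bigD1 l) //= eqxx big1 ?addr0 => [|a /negPf->].
    by rewrite mulrC.
  by rewrite mulr0.
under eq_bigr do rewrite DYX mulrBl; rewrite sumrB; congr (_ - _).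
  rewrite (bigD1 k) //= eqxx big1 ?addr0 => [|b]; first by rewrite mul1r mulrC.
  by rewrite eq_sym => /negPf->; rewrite !mul0r.
rewrite (bigD1 j) //= eqxx big1 ?addr0 => [|b]; first by rewrite mulr1.
by rewrite eq_sym => /negPf->; rewrite mulr0 mul0r.
Qed.

Variable s : nat.

Let Q (l : seq 'I_m) (t : 'S_m) := foldr (fun i => D i (t i)) (\det X ^+ s) l.

(** With [Z = X^-1], one has [D i j (det X ^ s) = s Z_ji det X ^ s] and
[D i j Z_kl = - Z_ki Z_jl].  So differentiating [det X ^ s * \prod_a Z_(t a, a)]
in the direction [(k, t k)] gives [s Z_(t k, k)] times it, and for each factor
[b] a term where [Z_(t k, k) Z_(t b, b)] is replaced by
[- Z_(t b, k) Z_(t k, b)].  In the alternating sum over [t] the exchange of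
[t b] and [t k] turns the latter into the former, and each factor present adds
one to [s].  The statement clears the denominators, by [Z = adj X / det X].

The sum is restricted to a set [U] of permutations that is not affected by the
values of [t] on [l], because the derivation added by the induction step depends
on [t k]: the induction hypothesis is used for the [t] with a given [t k]. *)
Lemma cayley_partial (l : seq 'I_m) (U : pred 'S_m) : uniq l ->
    (forall t t' : 'S_m, (forall i, i \notin l -> t i = t' i) -> U t = U t') ->
  \det X ^+ size l * \sum_(t | U t) (-1) ^+ t * Q l t =
  (\prod_(i < size l) (s + i))%N%:R * \det X ^+ s *
    \sum_(t | U t) (-1) ^+ t * \prod_(a <- l) (\adj X) (t a) a.
Proof.
set Y := \adj X.
elim: l U => [|k l IHl] U /=.
  move=> _ _; rewrite big_ord0 expr0 !mul1r mulr_sumr; apply: eq_bigr => t _.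
  by rewrite big_nil mulr1 mulrC.
case/andP=> kl Ul UP; rewrite big_ord_recr natrM /=.
set c := _%:R in IHl *.
pose G j := \sum_(t | U t && (t k == j)) (-1) ^+ t * \prod_(a <- l) Y (t a) a.
pose W j := \sum_(t | U t && (t k == j)) (-1) ^+ t *
  \sum_(b <- l) Y (t b) k * Y (t k) b * \prod_(a <- l | a != b) Y (t a) a.
have step j : \det X ^+ (size l).+1 *
    D k j (\sum_(t | U t && (t k == j)) (-1) ^+ t * Q l t) =
    c * \det X ^+ s * (s%:R * Y j k * G j - W j).
  set F := \sum_(t | _) _.
  have FG : \det X ^+ size l * F = c * \det X ^+ s * G j.
    apply: IHl => // t t' tt'; congr (_ && _); last by rewrite tt'.
    by apply: UP => i; rewrite inE negb_or => /andP[_ /tt'].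
  have GW : \det X * D k j (G j) = (size l)%:R * Y j k * G j - W j.
    rewrite /G /W raddf_sum !mulr_sumr -sumrB.
    apply: eq_bigr => t /andP[_ /eqP tk].
    rewrite der_sign mulrCA [X in _ = X - _]mulrCA -mulrBr; congr (_ * _).
    rewrite (der_prod (DM k j)) // mulr_sumr.
    rewrite (eq_big_seq (fun b => Y j k * \prod_(a <- l) Y (t a) a -
       Y (t b) k * Y (t k) b * \prod_(a <- l | a != b) Y (t a) a)); last first.
      move=> b bl; rewrite (bigD1_seq b) //= mulrA der_adj tk -/Y; ring.
    rewrite sumrB big_const_seq count_predT iter_addr addr0.
    by rewrite -mulrA mulr_natl.
  have := congr1 (fun p => \det X * D k j p) FG; rewrite /= !DM.
  have -> : D k j c = 0 by rewrite /c raddfMn (der1 (DM k j)) mul0rn.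
  rewrite mul0r add0r !mulrDr !mulrA.
  rewrite (der_exp (DM k j)) der_det -/Y => H.
  have -> : \det X ^+ (size l).+1 * D k j F =
    c * (\det X * D k j (\det X ^+ s)) * G j +
    c * \det X ^+ s * (\det X * D k j (G j)) -
    (size l)%:R * Y j k * (\det X ^+ size l * F).
    rewrite exprS; apply/eqP; rewrite eq_sym subr_eq; apply/eqP.
    rewrite addrC.
    transitivity (\det X * (c * D k j (\det X ^+ s)) * G j +
                  \det X * c * \det X ^+ s * D k j (G j)); first by ring.
    rewrite !mulrA in H *; rewrite -H; ring.
  rewrite FG (der_exp (DM k j)) der_det -/Y GW; ring.
rewrite (partition_big (fun t : 'S_m => t k) predT) //= mulr_sumr.
rewrite (eq_bigr (fun j =>
    c * \det X ^+ s * (s%:R * Y j k * G j - W j))) => [|j _]; last first.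
  rewrite -step raddf_sum; congr (_ * _).
  by apply: eq_bigr => t /andP[_ /eqP tk]; rewrite der_sign tk.
rewrite -mulr_sumr sumrB.
have -> : \sum_j W j = - (size l)%:R *
   \sum_(t | U t) (-1) ^+ t * \prod_(a <- k :: l) Y (t a) a.
  rewrite /W -(partition_big (fun t : 'S_m => t k) predT) //=.
  under eq_bigr do rewrite mulr_sumr; rewrite exchange_big /= big_seq.
  rewrite (eq_bigr (fun=>
    - \sum_(t | U t) (-1) ^+ t * \prod_(a <- k :: l) Y (t a) a)).
    rewrite -big_seq big_const_seq count_predT iter_addr addr0.
    by rewrite mulNrn mulNr mulr_natl.
  move=> b bl; have bk : b != k by rewrite (memPn kl).
  (* exchange the values of t at b and k *)
  rewrite (reindex_inj (mulgI (tperm b k))) /= -sumrN.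
  apply: eq_big => [t|t _].
    apply: UP => i; rewrite inE negb_or => /andP[ik il].
    by rewrite permM tpermD // 1?eq_sym // eq_sym (memPn il).
  rewrite odd_permM odd_tperm bk signr_addb expr1 mulN1r !permM tpermL tpermR.
  rewrite mulNr; congr (- (_ * _)).
  rewrite big_cons (bigD1_seq b) //= mulrA; congr (_ * _).
  rewrite big_seq_cond [RHS]big_seq_cond; apply: eq_bigr => a /andP[al ab].
  by rewrite permM tpermD // 1?eq_sym // (memPn kl).
have -> : \sum_j s%:R * Y j k * G j =
   s%:R * \sum_(t | U t) (-1) ^+ t * \prod_(a <- k :: l) Y (t a) a.
  rewrite (partition_big (fun t : 'S_m => t k) predT) //= mulr_sumr.
  apply: eq_bigr => j _; rewrite -mulrA; congr (_ * _).
  rewrite mulr_sumr; apply: eq_bigr => t /andP[_ /eqP tk].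
  by rewrite big_cons tk mulrCA.
rewrite natrD; ring.
Qed.

(** Both sides carry a surplus factor [det X ^ m.+1] if [s > 0], which can be
cancelled in a ring where [det X] is regular. *)
Lemma cayley_regular :
  \det X ^+ m.+1 * \sum_(t : 'S_m) (-1) ^+ t * Q (enum 'I_m) t =
  (\prod_(i < m) (s + i))%N%:R * \det X ^+ (s + m).
Proof.
have /= := @cayley_partial (enum 'I_m) xpredT (enum_uniq _)
  (fun _ _ _ => erefl).
rewrite size_enum_ord => E; rewrite exprS -mulrA E.
rewrite mulrCA -mulrA; congr (_ * _).
have -> : \sum_(t : 'S_m) (-1) ^+ t * \prod_(a <- enum 'I_m) (\adj X) (t a) a =
    \det (\adj X).
  rewrite -det_tr /determinant; apply: eq_bigr => t _; congr (_ * _).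
  by rewrite big_enum /=; apply: eq_bigr => a _; rewrite [RHS]mxE.
by rewrite -det_mulmx mul_mx_adj det_scalar exprD.
Qed.
End Cayley.

(** * The Fischer pairing *)

Section Fischer.
Variables (R : comNzRingType) (n : nat).
Implicit Types (p q f : {mpoly R[n]}) (k : 'X_{1..n}).

(** The constant term of [p(d/dX) f].  On monomials this is
[<X^k, X^l> = k! if k = l, and 0 otherwise], so the pairing is symmetric. *)
Definition fischer f p : R := \sum_(k <- msupp p) p@_k * (f^`M[k])@_0.

Lemma fischerwE f p b : (msize p <= b)%N ->
  fischer f p = \sum_(k : 'X_{1..n < b}) p@_k * (f^`M[k])@_0.
Proof.
move=> le_pb; rewrite /fischer (big_mksub 'X_{1..n < b}) /=; first last.
  by move=> x /msize_mdeg_lt/leq_trans/(_ le_pb).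
  by rewrite msupp_uniq.
by rewrite big_rmcond //= => j /memN_msupp_eq0 ->; rewrite mul0r.
Qed.

Lemma fischer_is_linear f : linear_for *%R (fischer f).
Proof.
move=> c p q; pose_big_enough b.
  rewrite !(@fischerwE f _ b) // mulr_sumr -big_split /=.
  by apply: eq_bigr => k _; rewrite mcoeffD mcoeffZ mulrDl mulrA.
by close.
Qed.

HB.instance Definition _ f :=
  GRing.isLinear.Build R {mpoly R[n]} R *%R (fischer f) (fischer_is_linear f).

Lemma fischerX f k : fischer f 'X_[k] = (f^`M[k])@_0.
Proof. by rewrite /fischer msuppX big_seq1 mcoeffX eqxx mul1r. Qed.

Lemma fischerD f g p : fischer (f + g) p = fischer f p + fischer g p.
Proof.
rewrite /fischer -big_split /=; apply: eq_bigr => k _.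
by rewrite mderivmD mcoeffD mulrDr.
Qed.

Lemma fischer_sumr (I : Type) (r : seq I) (Q : pred I)
    (F : I -> {mpoly R[n]}) p :
  fischer (\sum_(i <- r | Q i) F i) p = \sum_(i <- r | Q i) fischer (F i) p.
Proof.
elim/big_rec2: _ => [|i y f _ <-]; last by rewrite fischerD.
by rewrite /fischer big1 // => k _; rewrite linear0 mcoeff0 mulr0.
Qed.

Lemma fischerZ c f p : fischer (c *: f) p = c * fischer f p.
Proof.
rewrite /fischer mulr_sumr; apply: eq_bigr => k _.
by rewrite mderivmZ mcoeffZ mulrCA.
Qed.

(** Multiplication and differentiation are adjoint to each other. *)
Lemma fischerXM f k p : fischer f ('X_[k] * p) = fischer (f^`M[k]) p.
Proof.
elim/mpolyind: p => [|c l p _ _ IHp]; first by rewrite mulr0 !linear0.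
rewrite mulrDr !linearD /= IHp; congr (_ + _).
by rewrite -scalerAr !linearZ /= -mpolyXD !fischerX mderivmDm.
Qed.

End Fischer.

Section Permanent.
Variables (R : comNzRingType) (n : nat).

Lemma lift_perm_bij N : bijective
  (fun qr : 'I_N.+1 * 'S_N => lift_perm ord0 qr.1 qr.2).
Proof.
apply: inj_card_bij => [[q r] [q' r'] /= /permP E|]; last first.
  by rewrite card_prod card_Sn card_ord card_Sn factS.
have Eq : q = q' by have := E ord0; rewrite !lift_perm_id.
rewrite Eq in E *; congr (_, _); apply/permP => k.
by have := E (lift ord0 k); rewrite !lift_perm_lift => /lift_inj.
Qed.

(** By the Leibniz rule, [N] derivations applied to a product of [N] linear
forms give a permanent: each form is hit by exactly one derivation. *)
Lemma mderivm_prod_linear N (F : 'I_N -> {mpoly R[n]}) (c : 'I_N -> 'I_n -> R)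
    (e : 'I_N -> 'I_n) :
  (forall q v, (F q)^`M(v) = (c q v)%:MP) ->
  (\prod_q F q)^`M[\sum_p U_(e p)] =
  (\sum_(r : 'S_N) \prod_p c (r p) (e p))%:MP.
Proof.
elim: N F c e => [|N IHN] F c e Fc.
  rewrite !big_ord0 mderivm0m (big_pred1 1%g) => [|r].
    by rewrite big_ord0.
  by symmetry; apply/eqP/permP => -[].
have DM (p q : {mpoly R[n]}) :
    (p * q)^`M(e ord0) = p^`M(e ord0) * q + p * q^`M(e ord0).
  by rewrite mderivM.
rewrite big_ord_recl mderivmDm mderivmU1m.
rewrite (der_prod (D := mderiv (e ord0)) DM) ?index_enum_uniq //.
rewrite linear_sum /=.
rewrite (reindex _ (onW_bij _ (lift_perm_bij N))) /=.
rewrite -(pair_bigA _ (fun q (r : 'S_N) =>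
  \prod_p c (lift_perm ord0 q r p) (e p))) /=.
rewrite rmorph_sum; apply: eq_bigr => q _ /=.
rewrite Fc mderivm_mulC.
have -> : \prod_(j | j != q) F j = \prod_j F (lift q j).
  rewrite (reindex_omap (lift q) (unlift q)) => [|j jq].
    by apply: eq_bigl => j; rewrite liftK eqxx eq_sym neq_lift.
  by case: unliftP => //= [_ ->//|E]; rewrite E eqxx in jq.
rewrite (IHN _ (fun k => c (lift q k)) (fun k => e (lift ord0 k))) //.
rewrite -rmorphM mulr_sumr; congr (_%:MP); apply: eq_bigr => r _.
rewrite big_ord_recl lift_perm_id; congr (_ * _).
by apply: eq_bigr => k _; rewrite lift_perm_lift.
Qed.
End Permanent.

(** * The generic determinant as a polynomial and as an operator *)

Section GenericDet.
Variable m : nat.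

Definition gvar (R : nzRingType) (i j : 'I_m) : {mpoly R[m * m]} :=
  'X_(mxvec_index i j).

Definition gmx (R : nzRingType) : 'M[{mpoly R[m * m]}]_m :=
  \matrix_(i, j) gvar R i j.

Lemma mxvec_index_eq (i j k l : 'I_m) :
  (mxvec_index i j == mxvec_index k l) = (i == k) && (j == l).
Proof.
have /bij_inj inj : bijective (uncurry (@mxvec_index m m)).
  by have [g gK gK'] := curry_mxvec_bij m m; exists g => ?; rewrite ?gK ?gK'.
by rewrite -[RHS](inj_eq inj (i, j) (k, l)).
Qed.

Lemma mderiv_gvar (R : comNzRingType) i j k l :
  (gvar R k l)^`M(mxvec_index i j) = ((i == k) && (j == l))%:R.
Proof.
rewrite mderivX mnm1E mxvec_index_eq ![_ == k]eq_sym ![_ == l]eq_sym.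
case: andP => [[/eqP-> /eqP->]|_]; last by rewrite scale0r.
by rewrite scale1r -[X in (X - _)%MM]add0m addmK mpolyX0.
Qed.

(** The differential operator [det (d/dX)]. *)
Definition detdiff (R : comNzRingType) (f : {mpoly R[m * m]}) :=
  \sum_(t : 'S_m) (-1) ^+ t * f^`M[(\sum_i U_(mxvec_index i (t i)))%MM].

Lemma det_gmxE (R : comNzRingType) :
  \det (gmx R) =
  \sum_(t : 'S_m) (-1) ^+ t * 'X_[(\sum_i U_(mxvec_index i (t i)))%MM].
Proof.
apply: eq_bigr => t _; congr (_ * _).
rewrite (big_morph _ (@mpolyXD (m * m) R) (@mpolyX0 (m * m) R)).
by apply: eq_bigr => i _; rewrite !mxE.
Qed.

Lemma mpoly_signZ (R : comNzRingType) n (b : bool) (f : {mpoly R[n]}) :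
  (-1) ^+ b * f = (-1) ^+ b *: f.
Proof. by case: b; rewrite ?expr0 ?expr1 ?mul1r ?scale1r ?mulN1r ?scaleN1r. Qed.

Lemma fischer_detM (R : comNzRingType) f p :
  fischer f (\det (gmx R) * p) = fischer (detdiff f) p.
Proof.
rewrite det_gmxE mulr_suml linear_sum fischer_sumr; apply: eq_bigr => t _.
by rewrite -mulrA !mpoly_signZ linearZ fischerZ /= fischerXM.
Qed.

Lemma det_gmx_neq0 (R : comNzRingType) : \det (gmx R) != 0.
Proof.
apply/negP => /eqP /(congr1 (meval (fun v => mxvec 1%:M 0 v : R))).
rewrite -det_map_mx meval0.
have -> : map_mx (meval (fun v => mxvec 1%:M 0 v)) (gmx R) = 1%:M :> 'M[R]_m.
  by apply/matrixP=> i j; rewrite !mxE mevalXU mxvecE mxE.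
by rewrite det1 => /eqP; rewrite oner_eq0.
Qed.

Lemma mderivm_map (R S : comNzRingType) n (f : {rmorphism R -> S})
    (p : {mpoly R[n]}) k :
  (map_mpoly f p)^`M[k] = map_mpoly f (p^`M[k]).
Proof.
apply/mpolyP => l.
by rewrite mcoeff_map_mpoly !mcoeff_mderivm mcoeff_map_mpoly -raddfMn.
Qed.

Lemma map_det_gmx (R : comNzRingType) :
  map_mpoly intr (\det (gmx int)) = \det (gmx R).
Proof.
rewrite -det_map_mx; congr (\det _); apply/matrixP=> i j.
by rewrite !mxE; apply: map_mpolyX.
Qed.

Lemma foldr_mderiv (R : comNzRingType) n (f : {mpoly R[n]}) (I : Type)
    (r : seq I) (v : I -> 'I_n) :
  foldr (fun i => mderiv (v i)) f r = f^`M[(\sum_(i <- r) U_(v i))%MM].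
Proof.
elim: r => [|i r IHr]; first by rewrite big_nil mderivm0m.
by rewrite big_cons addmC mderivmDm mderivmU1m /= IHr.
Qed.

(** Cayley's identity.  Over the integers the generic determinant can be
cancelled from [cayley_regular]; the result then holds over every ring. *)
Lemma detdiff_detX (R : comNzRingType) s :
  detdiff (\det (gmx R) ^+ s.+1) =
  (\prod_(i < m) (s.+1 + i))%N%:R *: \det (gmx R) ^+ s.
Proof.
have Z : detdiff (\det (gmx int) ^+ s.+1) =
    (\prod_(i < m) (s.+1 + i))%N%:R * \det (gmx int) ^+ s.
  have DM (i j : 'I_m) (p q : {mpoly int[m * m]}) :
     mderiv (mxvec_index i j) (p * q) =
     mderiv (mxvec_index i j) p * q + p * mderiv (mxvec_index i j) q.
    by rewrite mderivM.
  have DX (i j k l : 'I_m) :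
     mderiv (mxvec_index i j) (gmx int k l) = ((i == k) && (j == l))%:R.
    by rewrite mxE mderiv_gvar.
  have := @cayley_regular _ m (fun i j => mderiv (mxvec_index i j)) (gmx int)
    DM DX s.+1.
  rewrite addSnnS addnC exprD mulrCA.
  move=> /(mulfI (expf_neq0 _ (det_gmx_neq0 _))) <-.
  apply: eq_bigr => t _; congr (_ * _).
  by rewrite (foldr_mderiv _ _ (fun i => mxvec_index i (t i))) big_enum.
have := congr1 (map_mpoly (intr : int -> R)) Z.
rewrite rmorphM rmorph_nat rmorphXn /= map_det_gmx => E.
rewrite scaler_nat -mulr_natl -E.
rewrite rmorph_sum; apply: eq_bigr => t _.
rewrite rmorphM rmorphXn rmorphN1 /=; congr (_ * _).
by rewrite -mderivm_map rmorphXn /= map_det_gmx.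
Qed.

Lemma fischer_det (R : comNzRingType) n :
  fischer (\det (gmx R) ^+ n) (\det (gmx R) ^+ n) =
    (\prod_(s < n) \prod_(i < m) (s.+1 + i))%N%:R.
Proof.
elim: n => [|n IHn].
  by rewrite big_ord0 expr0 -mpolyX0 fischerX mderivm0m mcoeffX eqxx.
rewrite [in X in fischer _ X]exprS fischer_detM detdiff_detX.
by rewrite fischerZ IHn big_ord_recr natrM mulrC.
Qed.
End GenericDet.

(** * Block-diagonal determinants *)

Section Blocks.
Variable R : comNzRingType.

Lemma det_reindex N N' (k : 'I_N' -> 'I_N) (M : 'M[R]_N) : bijective k ->
  \det (mxsub k k M) = \det M.
Proof.
move=> bk; have E : N' = N by rewrite -(card_ord N) -(bij_eq_card bk) card_ord.
subst N'; pose s := perm (bij_inj bk).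
have -> : mxsub k k M = row_perm s (col_perm s M).
  by apply/matrixP=> i j; rewrite !mxE !permE.
rewrite row_permE col_permE !det_mulmx !det_perm odd_permV.
by rewrite mulrCA -signr_addb addbb mulr1.
Qed.

(** The blocks are indexed by the first argument of [h], and need not consist of
consecutive indices: in the tableau, the columns do but the rows do not. *)
Lemma det_block_diag n m N (h : 'I_n * 'I_m -> 'I_N) (M : 'M[R]_N) :
    bijective h ->
    (forall j j' i i', j != j' -> M (h (j, i)) (h (j', i')) = 0) ->
  \det M = \prod_j \det (\matrix_(i, i') M (h (j, i)) (h (j, i'))).
Proof.
elim: n N h M => [|n IHn] N h M bh M0.
  have N0 : N = 0%N.
    by rewrite -(card_ord N) -(bij_eq_card bh) card_prod card_ord.
  by subst N; rewrite big_ord0 det_mx00.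
have [g gK Kg] := curry_mxvec_bij n m.
have [h' hK Kh] := bh.
pose k (u : 'I_(m + n * m)) := match split u with
  | inl i => h (0, i) | inr v => h (lift 0 (g v).1, (g v).2) end.
have bk : bijective k.
  apply: inj_card_bij => [u v|]; last first.
    by rewrite -(bij_eq_card bh) card_prod !card_ord mulSn.
  rewrite /k -{2}(splitK u) -{2}(splitK v).
  case: (split u) => a; case: (split v) => b /= /(bij_inj bh) // [].
  - by move=> ->.
  - move=> e1 e2; congr rshift; rewrite -(Kg a) // -(Kg b) //.
    rewrite (surjective_pairing (g a)) (surjective_pairing (g b)).
    by rewrite e2 (val_inj e1).
rewrite -(det_reindex M bk) -[mxsub k k M]submxK.
have -> : ursubmx (mxsub k k M) = 0.
  apply/matrixP=> i j; rewrite !mxE /k (unsplitK (inl i)) (unsplitK (inr j)).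
  exact: M0.
rewrite det_lblock big_ord_recl; congr (_ * _).
  congr (\det _); apply/matrixP=> i j; rewrite !mxE /k.
  by rewrite !(unsplitK (inl _)).
have b1 : bijective (uncurry (@mxvec_index n m)).
  by exists g => ?; rewrite ?gK ?Kg.
have E j j' i i' : drsubmx (mxsub k k M) (uncurry (@mxvec_index n m) (j, i))
    (uncurry (@mxvec_index n m) (j', i')) =
    M (h (lift 0 j, i)) (h (lift 0 j', i')).
  by rewrite !mxE /k !(unsplitK (inr _)) !gK.
rewrite (IHn _ _ _ b1) => [|j j' i i' jj']; last first.
  by rewrite E M0.
apply: eq_bigr => j _; congr (\det _); apply/matrixP=> i i'.
by rewrite [LHS]mxE [RHS]mxE E.
Qed.
End Blocks.

(** * The tableau expansion *)

Section Tableau.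
Variables (R : comNzRingType) (m n : nat).

Lemma tab_bij : bijective (fun ij : 'I_m * 'I_n => tab ij.1 ij.2).
Proof.
apply: inj_card_bij => [[i j] [i' j'] /= /(congr1 val) /= E|]; last first.
  by rewrite card_prod !card_ord.
have m_gt0 : (0 < m)%N by case: m i {i' E} => [[]|].
congr (_, _); apply: val_inj => /=.
  have := congr1 (modn^~ m) E.
  by rewrite /= !(addnC _ (_ * m)%N) !modnMDl !modn_small.
have := congr1 (divn^~ m) E.
by rewrite /= !(addnC _ (_ * m)%N) !divnMDl // !divn_small // !addn0.
Qed.

Lemma tab_flip_bij : bijective (fun ji : 'I_n * 'I_m => tab ji.2 ji.1).
Proof.
have [h hK Kh] := tab_bij; exists (fun q => ((h q).2, (h q).1)) => [[j i]|q] /=.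
  by rewrite (hK (i, j)).
exact: Kh.
Qed.

Variable g : 'I_(m * n) -> 'I_m * 'I_n.
Hypothesis tabK : forall i j, g (tab i j) = (i, j).
Let r q := (g q).1.
Let c q := (g q).2.

Lemma det_col_blocks (S : comNzRingType) (G : 'I_(m * n) -> 'I_m -> S) :
  \det (\matrix_(p, q) ((c q == c p)%:R * G p (r q))) =
  \prod_j \det (\matrix_(i, a) G (tab i j) a).
Proof.
rewrite (@det_block_diag _ n m _ (fun ji => tab ji.2 ji.1)) /=.
- apply: eq_bigr => j _; congr (\det _); apply/matrixP=> i a.
  by rewrite !mxE /c /r !tabK eqxx mul1r.
- exact: tab_flip_bij.
- by move=> j j' i i' jj'; rewrite mxE /c !tabK /= eq_sym (negPf jj') mul0r.
Qed.

Lemma det_row_blocks (S : comNzRingType) (G : 'I_(m * n) -> 'I_n -> S) :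
  \det (\matrix_(p, q) ((r q == r p)%:R * G p (c q))) =
  \prod_i \det (\matrix_(j, b) G (tab i j) b).
Proof.
rewrite (@det_block_diag _ m n _ (fun ij => tab ij.1 ij.2)) /=.
- apply: eq_bigr => j _; congr (\det _); apply/matrixP=> i a.
  by rewrite !mxE /c /r !tabK eqxx mul1r.
- exact: tab_bij.
- by move=> j j' i i' jj'; rewrite mxE /r !tabK /= eq_sym (negPf jj') mul0r.
Qed.

Variables (A : 'I_(m * n) -> 'I_m -> R) (B : 'I_(m * n) -> 'I_n -> R).

Let P := {mpoly R[m * m]}.
Let AB := \matrix_(p, q) (A p (r q) * B p (c q)).
Let ell i p : P := \sum_a A p a *: gvar R i a.
Let M : 'M[P]_(m * n) := \matrix_(p, q) ((B p (c q))%:MP * ell (r q) p).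

(** [M] is [AB] times [n] diagonal copies of the transposed generic matrix. *)
Lemma det_mixed :
  \det M = \det AB *: \det (gmx m R) ^+ n.
Proof.
pose K : 'M[P]_(m * n) :=
  \matrix_(q, q') ((c q' == c q)%:R * gvar R (r q) (r q')).
pose ABP := map_mx (mpolyC (m * m) (R := R)) AB.
have -> : M = ABP *m K^T.
  apply/matrixP=> p q; rewrite !mxE.
  rewrite (reindex _ (onW_bij _ tab_flip_bij)) /=.
  rewrite -(pair_bigA _ (fun j i => ABP p (tab i j) * K^T (tab i j) q)) /=.
  have KE i j : K^T (tab i j) q = (j == c q)%:R * gvar R (r q) i.
    by rewrite !mxE /c /r tabK.
  rewrite (bigD1 (c q)) //= [X in _ + X]big1 ?addr0; last first.
    by move=> j /negPf jq; apply: big1 => i _; rewrite KE jq mul0r mulr0.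
  rewrite mulr_sumr; apply: eq_bigr => a _.
  rewrite KE !mxE eqxx mul1r {2}/r {2}/c tabK /= -mul_mpolyC rmorphM /= mulrA.
  by rewrite [X in X * _]mulrC /c tabK.
rewrite det_mulmx det_map_mx mul_mpolyC det_tr; congr (_ *: _).
rewrite (det_col_blocks (fun q a => gvar R (r q) a)).
under eq_bigr => j _.
  have -> : \matrix_(i, a) gvar R (r (tab i j)) a = gmx m R.
    by apply/matrixP=> i a; rewrite !mxE /r tabK.
  over.
by rewrite prodr_const card_ord.
Qed.

(** The permutation [u] matches the derivation placed at cell [q] with the
linear form placed at cell [u q]; it contributes only if both are in the same
row. *)
Lemma fischer_prod (s t : 'S_(m * n)) :
  fischer (\prod_q ell (r q) (s q)) (\prod_q gvar R (r q) (r (t q))) =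
  \sum_(u : 'S_(m * n)) \prod_q ((r (u q) == r q)%:R * A (s (u q)) (r (t q))).
Proof.
have -> : \prod_q gvar R (r q) (r (t q)) =
    'X_[(\sum_q U_(mxvec_index (r q) (r (t q))))%MM].
  by rewrite (big_morph _ (@mpolyXD (m * m) R) (@mpolyX0 (m * m) R)).
rewrite fischerX.
pose cst q v := \sum_a A (s q) a * (v == mxvec_index (r q) a)%:R.
rewrite (@mderivm_prod_linear _ _ _ _ cst
  (fun q => mxvec_index (r q) (r (t q)))).
  rewrite mcoeffC eqxx mulr1; apply: eq_bigr => u _; apply: eq_bigr => q _.
  rewrite /cst (bigD1 (r (t q))) //= big1 => [|a /negPf ta].
    by rewrite mxvec_index_eq eqxx andbT addr0 mulrC eq_sym.
  by rewrite mxvec_index_eq [_ == a]eq_sym ta andbF mulr0.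
move=> q v; rewrite /ell linear_sum rmorph_sum; apply: eq_bigr => a _ /=.
rewrite mderivZ mderivX mnm1E eq_sym.
case: eqP => [->|_]; last by rewrite mulr0 scale0r scaler0 mpolyC0.
rewrite -[X in (X - _)%MM]add0m addmK mpolyX0 scale1r mulr1.
by rewrite -mul_mpolyC mulr1.
Qed.

(** Both sides are the pairing of [det M] with [(det X)^n].  For the left-hand
side, [s] and [t] below come from the expansions of [det M] and [(det X)^n], and
[u] from [fischer_prod]. *)
Lemma tableau_expansion :
  \sum_(s : 'S_(m * n)) (-1) ^+ s *
     (\prod_j \det (\matrix_(i, a) A (s (tab i j)) a)) *
     (\prod_i \det (\matrix_(j, b) B (s (tab i j)) b)) =
  (\prod_(s < n) \prod_(i < m) (s.+1 + i))%N%:R *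
    \det AB.
Proof.
rewrite mulrC -fischer_det -fischerZ -det_mixed.
have -> : \det (gmx m R) ^+ n =
    \sum_(t : 'S_(m * n)) (-1) ^+ t *
      \prod_q ((c (t q) == c q)%:R * gvar R (r q) (r (t q))).
  rewrite -[n in LHS]card_ord -prodr_const.
  transitivity (\det (\matrix_(p, q) ((c q == c p)%:R * gvar R (r p) (r q)))).
    rewrite (det_col_blocks (fun q a => gvar R (r q) a)).
    apply: eq_bigr => j _; congr (\det _); apply/matrixP=> i a.
    by rewrite !mxE /r tabK.
  by apply: eq_bigr => t _; congr (_ * _); apply: eq_bigr => q _; rewrite mxE.
have -> : \det M = \sum_(s : 'S_(m * n)) (-1) ^+ s *
    ((\prod_q B (s q) (c q))%:MP * \prod_q ell (r q) (s q)).
  rewrite -det_tr; apply: eq_bigr => s _; congr (_ * _).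
  rewrite rmorph_prod -big_split; apply: eq_bigr => q _.
  by rewrite mxE [LHS]mxE.
rewrite fischer_sumr.
transitivity (\sum_(s : 'S_(m * n)) \sum_(t : 'S_(m * n)) \sum_(u : 'S_(m * n))
    ((-1) ^+ s * (\prod_q B (s q) (c q))) *
    ((-1) ^+ t * \prod_q (c (t q) == c q)%:R) *
    \prod_q ((r (u q) == r q)%:R * A (s (u q)) (r (t q)))); last first.
  apply: eq_bigr => s _; rewrite linear_sum; apply: eq_bigr => t _ /=.
  rewrite -mulr_sumr -fischer_prod.
  rewrite mul_mpolyC mpoly_signZ scalerA fischerZ.
  rewrite -[LHS]mulrA; congr (_ * _).
  rewrite big_split /= -!natr_prod mpoly_signZ linearZ /= -[LHS]mulrA.
  congr (_ * _).
  by rewrite [in RHS]mulr_natl raddfMn /= mulr_natl.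
(* replace s by u^-1 * s, which moves u from the arguments of A to those of B *)
under [RHS]eq_bigr => s _ do rewrite exchange_big /=.
rewrite [RHS]exchange_big /=.
under [RHS]eq_bigr => u _ do rewrite (reindex_inj (mulgI u^-1)%g) /=.
rewrite [RHS]exchange_big /=; apply: eq_bigr => s _.
rewrite -(det_col_blocks (fun q a => A (s q) a)).
rewrite -(det_row_blocks (fun q b => B (s q) b)).
have sgB u : (-1) ^+ (u^-1 * s)%g * (\prod_q B ((u^-1 * s)%g q) (c q)) =
    (-1) ^+ s * ((-1) ^+ u * \prod_q B (s q) (c (u q))) :> R.
  rewrite odd_permM odd_permV addbC signr_addb -mulrA; congr (_ * (_ * _)).
  rewrite (reindex_inj (@perm_inj _ u)); apply: eq_bigr => q _.
  by rewrite permM permK.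
rewrite -mulrA mulr_suml mulr_sumr exchange_big; apply: eq_bigr => t _ /=.
rewrite mulr_sumr mulr_sumr.
apply: eq_bigr => u _; rewrite sgB.
have -> : \prod_q ((r (u q) == r q)%:R * A ((u^-1 * s)%g (u q)) (r (t q))) =
    \prod_q (r (u q) == r q)%:R * \prod_q A (s q) (r (t q)).
  by rewrite -big_split; apply: eq_bigr => q _; rewrite permM permK.
under eq_bigr do rewrite mxE.
have -> : \prod_i (\matrix_(p, q) ((r q == r p)%:R * B (s p) (c q))) i (u i) =
    \prod_q (r (u q) == r q)%:R * \prod_q B (s q) (c (u q)).
  by rewrite -big_split; apply: eq_bigr => q _; rewrite mxE.
rewrite big_split /=.
move: ((-1) ^+ s) ((-1) ^+ t) ((-1) ^+ u) => es et eu.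
move: (\prod_i (c (t i) == c i)%:R) (\prod_i A _ _) => pc pA.
move: (\prod_q (r (u q) == r q)%:R) (\prod_q B _ _) => pr pB.
ring.
Qed.
End Tableau.

(** * Inversions and the hook product *)

(** The Vandermonde determinant of the nodes [s 0, s 1, ...] differs from that
of [0, 1, ...] by the sign of [s]; by the product formula, the former is
negative or positive according to the parity of the number of inversions. *)
Lemma sign_perm_inversions (R : pzRingType) N (s : 'S_N) :
  (-1) ^+ #|[set pq : 'I_N * 'I_N | (pq.1 < pq.2)%N && (s pq.2 < s pq.1)%N]| =
  (-1) ^+ s :> R.
Proof.
suff E : (-1) ^+ #|[set pq : 'I_N * 'I_N |
    (pq.1 < pq.2)%N && (s pq.2 < s pq.1)%N]| = (-1) ^+ s :> int.
  by have := congr1 (intr : int -> R) E; rewrite !rmorphXn !rmorphN1.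
pose sgprod (t : 'S_N) : int :=
  Num.sg (\prod_(i < N) \prod_(j < N | (i < j)%N) ((t j)%:Z - (t i)%:Z)).
have sgE t : sgprod t =
    \prod_(i < N) \prod_(j < N | (i < j)%N) (-1) ^+ (t j < t i)%N.
  rewrite /sgprod (big_morph _ (@sgrM int) (@sgr1 int)); apply: eq_bigr => i _.
  rewrite (big_morph _ (@sgrM int) (@sgr1 int)); apply: eq_bigr => j ij.
  case: ltnP => [tji|]; first by rewrite ltr0_sg // subr_lt0 ltz_nat.
  rewrite leq_eqVlt => /orP[/eqP/val_inj/perm_inj ji|tij].
    by rewrite ji ltnn in ij.
  by rewrite gtr0_sg // subr_gt0 ltz_nat.
have detE (t : 'S_N) : \det (Vandermonde N (\row_j (t j)%:Z)) =
    (-1) ^+ t * \det (Vandermonde N (\row_j (j : nat)%:Z)).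
  have -> : Vandermonde N (\row_j (t j)%:Z) =
      col_perm t (Vandermonde N (\row_j (j : nat)%:Z)).
    by apply/matrixP=> i j; rewrite !mxE.
  by rewrite col_permE det_mulmx det_perm odd_permV mulrC.
have sgprodE t : sgprod t = Num.sg (\det (Vandermonde N (\row_j (t j)%:Z))).
  rewrite det_Vandermonde; congr Num.sg; apply: eq_bigr => i _.
  by apply: eq_bigr => j _; rewrite !mxE.
have sg_1 : sgprod 1%g = 1.
  rewrite sgE big1 // => i _; rewrite big1 // => j ij.
  by rewrite !perm1 ltnNge ltnW.
have sg_t : sgprod s = (-1) ^+ s * sgprod 1%g.
  have -> : sgprod 1%g = Num.sg (\det (Vandermonde N (\row_j (j : nat)%:Z))).
    rewrite sgprodE; congr (Num.sg (\det (Vandermonde _ _))).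
    by apply/rowP => j; rewrite !mxE perm1.
  rewrite sgprodE detE sgrM.
  by case: odd_perm; rewrite ?expr1 ?expr0 ?sgrN ?sgr1.
rewrite sg_1 mulr1 in sg_t; rewrite -sg_t sgE pair_big_dep /= -sum1_card.
rewrite (big_morph _ (@exprD int (-1)) (expr0 (-1))).
rewrite [RHS](bigID (fun ij : 'I_N * 'I_N => (s ij.2 < s ij.1)%N)) /=.
rewrite [X in _ = _ * X]big1.
  rewrite mulr1; apply: eq_big => [ij|ij]; first by rewrite inE.
  by rewrite inE => /andP[_ ->].
by move=> ij /andP[_ /negPf->].
Qed.

(** The factor of index [s] on the right is the one that Cayley's identity
produces from the power [s.+1] of the determinant. *)
Lemma hookHE m n : hookH m n = (\prod_(s < n) \prod_(i < m) (s.+1 + i))%N.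
Proof.
apply: eq_bigr => s _.
suff <- : ((\prod_(i < m) (s.+1 + i)) * s`! = (m + s)`!)%N.
  by rewrite mulnK ?fact_gt0.
elim: m => [|m IHm]; first by rewrite big_ord0 mul1n.
by rewrite big_ord_recr /= mulnAC IHm !addSn factS mulnC (addnC s m).
Qed.

(** * The degree-lexicographic list of monomials *)

Section Monomials.
Variables (s : nat) (Ms : 'I_s -> nat).

Lemma mem_monomials (e : {ffun 'I_s -> nat}) :
  (e \in monomials Ms) = [forall t, (e t < Ms t)%N].
Proof.
rewrite mem_sort; apply/mapP/forallP => [[f _ ->] t|e_lt].
  by rewrite ffunE ltn_ord.
exists ([ffun t => Ordinal (e_lt t)] : {dffun forall t, 'I_(Ms t)}).
  by rewrite mem_enum.
by apply/ffunP => t; rewrite !ffunE.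
Qed.

Lemma monomials_uniq : uniq (monomials Ms).
Proof.
rewrite sort_uniq map_inj_uniq ?enum_uniq // => e f /ffunP ef.
by apply/ffunP => t; apply: val_inj; have := ef t; rewrite !ffunE.
Qed.

Lemma deglex_total : total (@deglex s).
Proof.
move=> e f; rewrite /deglex; case: ltngtP => //= _; exact: le_total.
Qed.

Lemma deglex_trans : transitive (@deglex s).
Proof.
move=> f e h /orP[ef|/andP[/eqP ef le_ef]] /orP[fh|/andP[/eqP fh le_fh]].
- by rewrite /deglex (ltn_trans ef fh).
- by rewrite /deglex -fh ef.
- by rewrite /deglex ef fh.
- by rewrite /deglex ef fh eqxx (le_trans le_fh le_ef) orbT.
Qed.

Lemma deglex_anti : antisymmetric (@deglex s).
Proof.
move=> e f; rewrite /deglex; case: ltngtP => //= _ /le_anti E.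
by apply/ffunP => t; move/eq_in_map: E => ->; rewrite ?mem_enum.
Qed.

Lemma index_monomials e f : e \in monomials Ms -> f \in monomials Ms ->
  ~~ deglex e f = (index f (monomials Ms) < index e (monomials Ms))%N.
Proof.
move=> eM fM.
have sM : sorted (@deglex s) (monomials Ms) := sort_sorted deglex_total _.
rewrite ltnNge; congr negb; apply/idP/idP.
  rewrite leqNgt; apply: contraL => lt_fe; apply/negP => le_ef.
  have le_fe := sorted_ltn_index deglex_trans sM _ _ fM eM lt_fe.
  by move: lt_fe; rewrite (@deglex_anti e f) ?ltnn // le_ef.
rewrite leq_eqVlt => /orP[/eqP E|].
  have -> : e = f by rewrite -(nth_index e eM) E nth_index.
  by have := deglex_total f f; rewrite orbb.
exact: (sorted_ltn_index deglex_trans sM).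
Qed.

End Monomials.

(** * Two orders on the columns of the Vandermonde matrix *)

Definition monomial_val (R : comUnitRingType) s (Ms : 'I_s -> nat)
    (x : 'rV[R]_s) (j : nat) : R :=
  \prod_t x 0 t ^+ monomial Ms j t.

Section Split.
Variables (k l : nat) (N : 'I_(k + l) -> nat) (m n : nat).
Hypothesis mE : m = (\prod_(t < k) N (lshift l t))%N.
Hypothesis nE : n = (\prod_(t < l) N (rshift k t))%N.

Lemma monomial_mem s (Ms : 'I_s -> nat) i : (i < \prod_t Ms t)%N ->
  monomial Ms i \in monomials Ms.
Proof. by move=> lt_i; rewrite mem_nth // size_monomials. Qed.

Lemma prodmonomial_mem (i : 'I_m) (j : 'I_n) :
  prodmonomial N i j \in monomials N.
Proof.
rewrite mem_monomials; apply/forallP => t; rewrite ffunE.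
have := monomial_mem (Ms := fun t => N (lshift l t)) (i := i).
have := monomial_mem (Ms := fun t => N (rshift k t)) (i := j).
rewrite -mE -nE !ltn_ord !mem_monomials.
move=> /(_ isT)/forallP Hb /(_ isT)/forallP Ha.
by rewrite -{2}[t]splitK; case: (split t) => a; rewrite ?Ha ?Hb.
Qed.

Lemma prodmonomial_inj (i i' : 'I_m) (j j' : 'I_n) :
  prodmonomial N i j = prodmonomial N i' j' -> (i, j) = (i', j').
Proof.
move=> /ffunP E.
have szA : size (monomials (fun t => N (lshift l t))) = m.
  by rewrite size_monomials mE.
have szB : size (monomials (fun t => N (rshift k t))) = n.
  by rewrite size_monomials nE.
congr (_, _); apply: val_inj.
  apply: (uniqP [ffun=> 0%N] (monomials_uniq (fun t => N (lshift l t))));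
    rewrite ?inE ?szA ?ltn_ord //.
  apply/ffunP => t; have := E (lshift l t).
  by rewrite !ffunE (unsplitK (inl t)).
apply: (uniqP [ffun=> 0%N] (monomials_uniq (fun t => N (rshift k t))));
  rewrite ?inE ?szB ?ltn_ord //.
apply/ffunP => t; have := E (rshift k t).
by rewrite !ffunE (unsplitK (inr t)).
Qed.

(** The cell [q] of the tableau stands for the product of the monomials
[(g q).1] and [(g q).2].  Sending [q] to the place of this product in the
degree-lexicographic list is a permutation whose inversions are the pairs
counted by [order_inversions]. *)
Lemma vandermonde_reorder (R : comUnitRingType)
    (z : 'I_(m * n) -> 'rV[R]_(k + l)) (g : 'I_(m * n) -> 'I_m * 'I_n) :
    cancel (fun ij => tab ij.1 ij.2) g -> cancel g (fun ij => tab ij.1 ij.2) ->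
  \det (vandermonde N z) = (-1) ^+ order_inversions N m n *
    \det (\matrix_(p, q)
      (monomial_val (fun t => N (lshift l t)) (lsubmx (z p)) (g q).1 *
       monomial_val (fun t => N (rshift k t)) (rsubmx (z p)) (g q).2)).
Proof.
move=> gK Kg; pose mon q := prodmonomial N (g q).1 (g q).2.
have memM q : mon q \in monomials N by apply: prodmonomial_mem.
have ltM q : (index (mon q) (monomials N) < m * n)%N.
  rewrite [X in (_ < X)%N](_ : _ = size (monomials N)) ?index_mem //.
  by rewrite size_monomials big_split_ord mE nE.
have injM : injective (fun q => Ordinal (ltM q)).
  move=> q q' /(congr1 val) /= /(congr1 (nth [ffun=> 0%N] (monomials N))).
  rewrite !nth_index // => /prodmonomial_inj E.
  apply: (can_inj Kg).
  by rewrite (surjective_pairing (g q)) E -surjective_pairing.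
pose s := perm injM.
have -> : order_inversions N m n =
    #|[set pq : 'I_(m * n) * 'I_(m * n) |
        (pq.1 < pq.2)%N && (s pq.2 < s pq.1)%N]|.
  pose h (pq : 'I_(m * n) * 'I_(m * n)) := (g pq.1, g pq.2).
  have h_inj : injective h.
    by move=> [p q] [p' q'] [/(can_inj Kg)-> /(can_inj Kg)->].
  rewrite -(card_imset _ h_inj); apply: eq_card => -[ij ij'].
  rewrite inE; apply/idP/imsetP => [/= H|[[p q]]].
    exists (tab ij.1 ij.2, tab ij'.1 ij'.2); last by rewrite /h !gK.
    rewrite inE /= !permE /= -index_monomials //.
    by rewrite /mon !gK.
  rewrite inE /= !permE /= -index_monomials // => H [-> ->].
  by move: H; rewrite -{1}(Kg p) -{1}(Kg q).
rewrite (sign_perm_inversions R s).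
set M := \matrix_(p, q) _.
have -> : M = col_perm s (vandermonde N z).
  apply/matrixP => p q; rewrite !mxE permE /= /monomial nth_index //.
  rewrite big_split_ord.
  congr (_ * _); apply: eq_bigr => t _; rewrite !mxE !ffunE.
    by rewrite (unsplitK (inl t)).
  by rewrite (unsplitK (inr t)).
rewrite col_permE det_mulmx det_perm odd_permV.
by rewrite mulrCA -signr_addb addbb mulr1.
Qed.
End Split.

Theorem theorem2p5 (R : comUnitRingType) (k l : nat)
    (N : 'I_(k + l) -> nat) (m n : nat)
    (k_gt0 : (0 < k)%N) (l_gt0 : (0 < l)%N)
    (N_ge2 : forall t, (2 <= N t)%N)
    (mE : m = (\prod_(t < k) N (lshift l t))%N)
    (nE : n = (\prod_(t < l) N (rshift k t))%N)
    (le_nm : (n <= m)%N)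
    (H_unit : (hookH m n)%:R \is a @GRing.unit R)
    (z : 'I_(m * n) -> 'rV[R]_(k + l)) :
  \det (vandermonde N z) =
    (-1) ^+ order_inversions N m n *
    ((hookH m n)%:R^-1 *
     \sum_(s : 'S_(m * n)) (-1) ^+ s *
       (\prod_(j < n) \det (vandermonde (fun t => N (lshift l t))
                              (fun i => lsubmx (z (tabcol s j i))))) *
       (\prod_(i < m) \det (vandermonde (fun t => N (rshift k t))
                              (fun j => rsubmx (z (tabrow s i j)))))).
Proof.
have [g gK Kg] := tab_bij m n.
rewrite (vandermonde_reorder mE nE z gK Kg); congr (_ * _).
apply: (mulrI H_unit); rewrite mulVKr // hookHE.
rewrite -(tableau_expansion (fun i j => gK (i, j))
  (fun p => monomial_val (fun t => N (lshift l t)) (lsubmx (z p)))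
  (fun p => monomial_val (fun t => N (rshift k t)) (rsubmx (z p)))).
apply: eq_bigr => s _; congr (_ * _ * _); apply: eq_bigr => i _; congr (\det _);
  by apply/matrixP => a b; rewrite !mxE.
Qed.
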